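(* Let $n\ge1$ and let $\alpha,\beta\vDash n$ be compositions. 1. If $\beta\le_d\alpha$ and $\ell(\alpha)=\ell(\beta)$, then $\mathrm{SIT}_{\mathfrak{S}^*}(\alpha;\beta)\ne\emptyset$. 2. If $\beta^r\le_d\alpha^r$ and $\ell(\alpha)=\ell(\beta)$, then $\mathrm{SRIT}_{\mathfrak{S}^*}(\alpha;\beta)\ne\emptyset$. 3. If $\beta^c\le_d\alpha$ and $\ell(\alpha)=n+1-\ell(\beta)$, then $\mathrm{SIT}_{R\mathfrak{S}^*}(\alpha;\beta)\ne\emptyset$. 4. If $\beta^t\le_d\alpha^r$ and $\ell(\alpha)=n+1-\ell(\beta)$, then $\mathrm{SRIT}_{R\mathfrak{S}^*}(\alpha;\beta)\ne\emptyset$.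
   Context: A composition $\alpha=(\alpha_1,\dots,\alpha_\ell)\vDash n$ is a finite list of positive integers with sum $n$; $\ell(\alpha)=\ell$. Write $\mathrm{Set}(\alpha)=\{\alpha_1,\alpha_1+\alpha_2,\dots,\alpha_1+\cdots+\alpha_{\ell-1}\}\subseteq[n-1]=\{1,\dots,n-1\}$, and let $\mathrm{Comp}$ be the inverse bijection from subsets of $[n-1]$ to compositions of $n$. The reverse is $\alpha^r=(\alpha_\ell,\dots,\alpha_1)$, the complement is $\alpha^c=\mathrm{Comp}([n-1]\setminus\mathrm{Set}(\alpha))$, and the transpose is $\alpha^t=(\alpha^c)^r=(\alpha^r)^c$. Dominance order: for $\alpha,\beta\vDash n$, $\beta\le_d\alpha$ if $\sum_{i=1}^k\beta_i\le\sum_{i=1}^k\alpha_i$ for all $1\le k\le\min\{\ell(\alpha),\ell(\beta)\}$. The diagram of $\alpha$ is the left-justified array of cells with $\alpha_i$ cells in row $i$, rows numbered from bottom to top. $\mathrm{SIT}(\alpha)$ (standard immaculate tableaux) is the set of bijective fillings of the diagram of $\alpha$ with $1,\dots,n$ such that entries increase from bottom to top in the first (leftmost) column and from left to right in each row. $\mathrm{SRIT}(\alpha)$ (standard reverse immaculate tableaux) is the set of bijective fillings with $1,\dots,n$ such that entries increase from bottom to top in the first (leftmost) column and from right to left in each row. For $T$ in either set, $\mathrm{Des}_{\mathfrak{S}^*}(T)=\{i\in[n-1]\mid i+1$ is in a strictly higher row than $i$ in $T\}$ and $\mathrm{Des}_{R\mathfrak{S}^*}(T)=\{i\in[n-1]\mid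 i+1$ is in the same row as or a lower row than $i$ in $T\}$. For $\ast\in\{\mathfrak{S}^*,R\mathfrak{S}^*\}$, the $\ast$-descent composition of $T$ is $\mathrm{Comp}(\mathrm{Des}_\ast(T))$, and $\mathrm{SIT}_\ast(\alpha;\beta)$ (resp. $\mathrm{SRIT}_\ast(\alpha;\beta)$) is the set of $T\in\mathrm{SIT}(\alpha)$ (resp. $T\in\mathrm{SRIT}(\alpha)$) with $\ast$-descent composition $\beta$. *)

(* Defs.v *)
From mathcomp Require Import all_boot.

Set Implicit Arguments.
Unset Strict Implicit.
Unset Printing Implicit Defensive.

Definition is_comp (n : nat) (a : seq nat) : bool :=
  all (ltn 0) a && (sumn a == n).

(* [n-1] = {1, ..., n-1}, as a set of elements of 'I_n = {0, ..., n-1}. *)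
Definition interval_pred (n : nat) : {set 'I_n} := [set i : 'I_n | 0 < i].

(* Set(a): the partial sums a_1 + ... + a_k for 1 <= k <= l(a) - 1. *)
Definition set_of_comp (n : nat) (a : seq nat) : {set 'I_n} :=
  [set i : 'I_n | [exists k : 'I_(size a), (0 < k) && (sumn (take k a) == i)]].

(* Comp(S): the successive differences of 0 < s_1 < ... < s_m < n, where
   S = {s_1 < ... < s_m}; [enum S] lists S in increasing order. For n > 0 it
   is inverse to set_of_comp, see comp_of_setK and set_of_compK below. *)
Definition comp_of_set (n : nat) (S : {set 'I_n}) : seq nat :=
  pairmap (fun x y => y - x) 0 (rcons [seq val i | i <- enum S] n).

Definition comp_compl (n : nat) (a : seq nat) : seq nat :=
  comp_of_set (interval_pred n :\: set_of_comp n a).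

Definition comp_transp (n : nat) (a : seq nat) : seq nat :=
  rev (comp_compl n a).

Definition dom_le (b a : seq nat) : Prop :=
  forall k : nat, 1 <= k <= minn (size a) (size b) ->
    sumn (take k b) <= sumn (take k a).

(* Cells are 0-indexed (row, column) pairs. Row 0 is the bottom row, so a
   higher row has a larger index; column 0 is the leftmost column. *)
Definition cell (a : seq nat) : finType :=
  {i : 'I_(size a) & 'I_(nth 0 a i)}.

Definition row (a : seq nat) (c : cell a) : nat := tag c.
Definition col (a : seq nat) (c : cell a) : nat := tagged c.

Definition filling (n : nat) (a : seq nat) : finType :=
  {ffun cell a -> 'I_n.+1}.

(* The entries are exactly 1, ..., n, each used once; 0 : 'I_n.+1 is unused. *)
Definition bij_filling (n : nat) (a : seq nat) (T : filling n a) : bool :=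
  injectiveb T && [forall v : 'I_n.+1, (v \in codom T) == (0 < v)].

Definition first_col_incr (n : nat) (a : seq nat) (T : filling n a) : bool :=
  [forall c : cell a, forall d : cell a,
     [&& col c == 0, col d == 0 & row c < row d] ==> (T c < T d)].

Definition rows_incr (n : nat) (a : seq nat) (T : filling n a) : bool :=
  [forall c : cell a, forall d : cell a,
     (row c == row d) && (col c < col d) ==> (T c < T d)].

Definition rows_decr (n : nat) (a : seq nat) (T : filling n a) : bool :=
  [forall c : cell a, forall d : cell a,
     (row c == row d) && (col c < col d) ==> (T d < T c)].

Definition SIT (n : nat) (a : seq nat) : {set filling n a} :=
  [set T : filling n a | [&& bij_filling T, first_col_incr T & rows_incr T]].

Definition SRIT (n : nat) (a : seq nat) : {set filling n a} :=
  [set T : filling n a | [&& bij_filling T, first_col_incr T & rows_decr T]].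

Definition DesS (n : nat) (a : seq nat) (T : filling n a) : {set 'I_n} :=
  [set i in interval_pred n | [exists c : cell a, exists d : cell a,
     [&& val (T c) == i, val (T d) == i.+1 & row c < row d]]].

Definition DesRS (n : nat) (a : seq nat) (T : filling n a) : {set 'I_n} :=
  [set i in interval_pred n | [exists c : cell a, exists d : cell a,
     [&& val (T c) == i, val (T d) == i.+1 & row d <= row c]]].

Definition SIT_S (n : nat) (a b : seq nat) : {set filling n a} :=
  [set T in SIT n a | comp_of_set (DesS T) == b].

Definition SRIT_S (n : nat) (a b : seq nat) : {set filling n a} :=
  [set T in SRIT n a | comp_of_set (DesS T) == b].

Definition SIT_RS (n : nat) (a b : seq nat) : {set filling n a} :=
  [set T in SIT n a | comp_of_set (DesRS T) == b].

Definition SRIT_RS (n : nat) (a b : seq nat) : {set filling n a} :=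
  [set T in SRIT n a | comp_of_set (DesRS T) == b].

Lemma pairmap_scanl (s : seq nat) (x : nat) :
  pairmap (fun x y => y - x) x (scanl addn x s) = s.
Proof. by elim: s x => //= y s IHs x; rewrite addKn IHs. Qed.

Lemma scanl_pairmap (s : seq nat) (x : nat) : path leq x s ->
  scanl addn x (pairmap (fun x y => y - x) x s) = s.
Proof.
by elim: s x => //= y s IHs x /andP[xy ys]; rewrite subnKC // IHs.
Qed.

Lemma nth_scanl_addn (s : seq nat) (x k : nat) : k < size s ->
  nth 0 (scanl addn x s) k = x + sumn (take k.+1 s).
Proof.
by elim: s x k => //= y s IHs x [|k] ks; rewrite ?take0 ?addn0 //= IHs ?addnA.
Qed.

Lemma sorted_enum_ord (n : nat) (S : {set 'I_n}) :
  sorted ltn [seq val i | i <- enum S].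
Proof.
have sub : subseq (enum S) (enum 'I_n).
  by rewrite enumT {1}/enum_mem; apply: filter_subseq.
apply: (subseq_sorted ltn_trans (map_subseq val sub)).
by rewrite val_enum_ord iota_ltn_sorted.
Qed.

Lemma mem_set_of_comp (n : nat) (a : seq nat) (i : 'I_n) :
  (i \in set_of_comp n a) = (val i \in take (size a).-1 (scanl addn 0 a)).
Proof.
rewrite inE; apply/existsP/idP => [[[[|k] ka] //= /eqP ki]|].
  have k1 : k < (size a).-1 by rewrite -ltnS (ltn_predK ka).
  apply/(nthP 0); exists k; first by rewrite size_take_min size_scanl leq_min k1 ltnW.
  by rewrite nth_take // nth_scanl_addn ?ki // ltnW.
case/(nthP 0)=> k; rewrite size_take_min size_scanl leq_min => /andP[k1 k2].
have k3 : k.+1 < size a by rewrite -(ltn_predK k2) ltnS.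
rewrite nth_take // nth_scanl_addn // add0n => ki.
by exists (Ordinal k3); rewrite /= ki.
Qed.

Lemma scanl_comp (n : nat) (a : seq nat) : 0 < n -> is_comp n a ->
  scanl addn 0 a = rcons (take (size a).-1 (scanl addn 0 a)) n.
Proof.
move=> n0 /andP[_ /eqP an].
have a0 : 0 < size a by case: a an => //= an; rewrite -an in n0.
have a1 : (size a).-1 < size a by rewrite ltn_predL.
have nE : nth 0 (scanl addn 0 a) (size a).-1 = n.
  by rewrite nth_scanl_addn // (ltn_predK a0) take_size.
rewrite -[X in rcons _ X]nE -take_nth ?size_scanl // (ltn_predK a0).
by rewrite take_oversize // size_scanl.
Qed.

Lemma sorted_scanl (s : seq nat) (x : nat) : all (ltn 0) s ->
  path ltn x (scanl addn x s).
Proof.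
elim: s x => //= y s IHs x /andP[y0 s0].
by rewrite IHs // andbT -[ltnLHS]addn0 ltn_add2l.
Qed.

Lemma comp_of_setK (n : nat) (a : seq nat) : 0 < n -> is_comp n a ->
  comp_of_set (set_of_comp n a) = a.
Proof.
move=> n0 ca; have sE := scanl_comp n0 ca.
have : path ltn 0 (scanl addn 0 a) by apply: sorted_scanl; case/andP: ca.
rewrite /comp_of_set -[RHS](pairmap_scanl a 0) sE => /path_sorted sa.
have := sa; rewrite -cats1 sorted_pairwise; last exact: ltn_trans.
rewrite pairwise_cat allrel1r => /and3P[/allP ltan pa _].
rewrite cats1; congr (pairmap _ _ (rcons _ _)).
apply: (irr_sorted_eq ltn_trans ltnn) => [||v]; first exact: sorted_enum_ord.
  by rewrite sorted_pairwise //; exact: ltn_trans.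
apply/mapP/idP => [[i iS ->]|va].
  by rewrite -mem_set_of_comp -mem_enum.
have vn : v < n by exact: ltan va.
by exists (Ordinal vn); rewrite // mem_enum mem_set_of_comp.
Qed.

Lemma path_enum_interval (n : nat) (S : {set 'I_n}) : 0 < n ->
  S \subset interval_pred n -> path ltn 0 (rcons [seq val i | i <- enum S] n).
Proof.
move=> n0 /subsetP sS; rewrite (path_sortedE ltn_trans) all_rcons /= n0 /=.
apply/andP; split.
  by apply/allP=> v /mapP[i]; rewrite mem_enum => /sS; rewrite inE => i0 ->.
rewrite -cats1 sorted_pairwise; last exact: ltn_trans.
rewrite pairwise_cat allrel1r -sorted_pairwise; last exact: ltn_trans.
rewrite sorted_enum_ord /= andbT;
by apply/allP=> v /mapP[i _ ->]; apply: ltn_ord.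
Qed.

Lemma scanl_comp_of_set (n : nat) (S : {set 'I_n}) : 0 < n ->
  S \subset interval_pred n ->
  scanl addn 0 (comp_of_set S) = rcons [seq val i | i <- enum S] n.
Proof.
move=> n0 sS; apply: scanl_pairmap.
by apply: sub_path (path_enum_interval n0 sS) => x y; apply: ltnW.
Qed.

Lemma set_of_compK (n : nat) (S : {set 'I_n}) : 0 < n ->
  S \subset interval_pred n -> set_of_comp n (comp_of_set S) = S.
Proof.
move=> n0 sS; apply/setP=> i; rewrite mem_set_of_comp scanl_comp_of_set //.
rewrite size_pairmap size_rcons -cats1 take_size_cat //.
by rewrite (mem_map val_inj) mem_enum.
Qed.

Lemma pairmap_gt0 (s : seq nat) (x : nat) :
  path ltn x s -> all (ltn 0) (pairmap (fun x y => y - x) x s).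
Proof. by elim: s x => //= y s IHs x /andP[xy ys]; rewrite subn_gt0 xy IHs. Qed.

Lemma comp_of_setP (n : nat) (S : {set 'I_n}) : 0 < n ->
  S \subset interval_pred n -> is_comp n (comp_of_set S).
Proof.
move=> n0 sS; apply/andP; split.
  exact: pairmap_gt0 (path_enum_interval n0 sS).
have lastE (s : seq nat) (x : nat) : last x (scanl addn x s) = x + sumn s.
  by elim: s x => [|y s IHs] x /=; rewrite ?addn0 // IHs addnA.
by rewrite -[sumn _]add0n -lastE scanl_comp_of_set // last_rcons.
Qed.

(* Main.v *)
Require Import Defs.
From mathcomp Require Import all_boot zify.

Set Implicit Arguments.
Unset Strict Implicit.
Unset Printing Implicit Defensive.

(** Recording for each v the row of the entry v turns a tableau into a word,
    in which i is a descent exactly when the letter after the i-th is larger.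
    For a standard immaculate tableau the rows start in the order 0, 1, 2, ...,
    so the existence question is about words with content a, whose letters
    first occur in increasing order and whose strict ascents are at the partial
    sums of b.

    Cut such a word into weakly decreasing blocks of sizes b_0, b_1, ...  When
    there are as many blocks as rows, block k has to start with the first
    occurrence of k and to continue with letters at most k.  All the freedom
    lies in distributing the other occurrences of the letters, a_i - 1 of each
    letter i.  List them in increasing order and cut this list into pieces of
    sizes b_k - 1: piece k contains only letters at most k precisely because
    b_0 + ... + b_k <= a_0 + ... + a_k, which is dominance.  Sorting every
    piece in decreasing order gives the word ([immaculate_word]).  The
    positions of the letter i in this word are then the entries of row i
    ([SIT_reading]).

    The other three parts reduce to this one.  Turning a tableau upside down
    and replacing each entry v by n + 1 - v exchanges the two kinds of tableaux
    while reversing both the shape and the descent composition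
    ([SRIT_reading]).  The two kinds of descent sets of a tableau are
    complementary ([DesRS_compl]), so that descent composition b of the second
    kind means descent composition comp_compl n b of the first kind, whose
    length is n + 1 - size b ([size_comp_compl]). *)

(** * The word of a tableau with prescribed descents *)

Lemma sumn_predn (s : seq nat) : all (ltn 0) s ->
  sumn (map predn s) = sumn s - size s.
Proof.
move=> s0; suff : sumn (map predn s) + size s = sumn s by lia.
by elim: s s0 => //= x s IHs /andP[x0 /IHs]; lia.
Qed.

(** The rows of the cells outside the first column, row after row. *)
Definition spare_rows (a : seq nat) : seq nat :=
  flatten [seq nseq (nth 0 a i).-1 i | i <- iota 0 (size a)].

Definition block (a b : seq nat) (k : nat) : seq nat :=
  k :: sort geq (nth [::] (reshape (map predn b) (spare_rows a)) k).

Definition tableau_word (a b : seq nat) : seq nat :=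
  flatten (mkseq (block a b) (size b)).

Lemma shape_spare (a : seq nat) (m : nat) : m <= size a ->
  shape [seq nseq (nth 0 a i).-1 i | i <- iota 0 m] = map predn (take m a).
Proof.
move=> ma; rewrite -(map_nth_iota0 0 ma) /shape -!map_comp.
by apply: eq_map => i /=; rewrite size_nseq.
Qed.

Lemma size_spare_rows (a : seq nat) : all (ltn 0) a ->
  size (spare_rows a) = sumn a - size a.
Proof. by move=> a0; rewrite size_flatten shape_spare // take_size sumn_predn. Qed.

(** The rows up to k have sumn (take k.+1 a) - k.+1 cells outside the first
    column, and these are the ones listed first. *)
Lemma mem_take_spare_rows (a : seq nat) (k m x : nat) : all (ltn 0) a ->
  k < size a -> m <= sumn (take k.+1 a) - k.+1 ->
  x \in take m (spare_rows a) -> x <= k.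
Proof.
move=> a0 ka mk; rewrite /spare_rows -(subnKC ka) iotaD map_cat flatten_cat.
rewrite takel_cat => [/mem_take/flatten_mapP[i]|].
  by rewrite mem_iota mem_nseq => ik /andP[_ /eqP->].
rewrite size_flatten shape_spare //.
rewrite sumn_predn ?size_takel //.
by move: a0; rewrite -[X in all _ X](cat_take_drop k.+1) all_cat => /andP[].
Qed.

Lemma shape_blocks (a b : seq nat) : all (ltn 0) a -> all (ltn 0) b ->
  sumn a = sumn b -> size a = size b ->
  shape (mkseq (block a b) (size b)) = b.
Proof.
move=> a0 b0 sab zab; apply: (@eq_from_nth _ 0); rewrite size_map size_mkseq // => k kb.
rewrite (nth_map [::]) ?size_mkseq // nth_mkseq //= size_sort.
have <- : nth 0 (shape (reshape (map predn b) (spare_rows a))) k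
        = size (nth [::] (reshape (map predn b) (spare_rows a)) k).
  by rewrite (nth_map [::]) // size_reshape size_map.
rewrite reshapeKl ?sumn_predn ?size_spare_rows ?sab ?zab //.
by rewrite (nth_map 0) // prednK //; apply: (all_nthP 0 b0).
Qed.

(** This is where dominance enters: the pieces up to the k-th have altogether
    b_0 + ... + b_k - (k + 1) letters, at most the number of spare cells in
    rows up to k. *)
Lemma block_le (a b : seq nat) (k x : nat) : all (ltn 0) a -> all (ltn 0) b ->
  dom_le b a -> size a = size b -> k < size b -> x \in block a b k -> x <= k.
Proof.
move=> a0 b0 dba zab kb; rewrite inE => /predU1P[-> //|].
rewrite mem_sort nth_reshape take_drop => /mem_drop.
apply: mem_take_spare_rows; rewrite ?zab //.
have {}dba : sumn (take k.+1 b) <= sumn (take k.+1 a) by apply: dba; rewrite zab minnn.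
apply: leq_trans (leq_sub2r k.+1 dba).
rewrite -[X in _ <= _ - X](size_takel kb) -sumn_predn.
  by rewrite (take_nth 0 kb) map_rcons sumn_rcons map_take (nth_map 0) // addnC.
by move: b0; rewrite -[X in all _ X](cat_take_drop k.+1) all_cat => /andP[].
Qed.

Lemma sorted_block (a b : seq nat) (k : nat) : all (ltn 0) a -> all (ltn 0) b ->
  dom_le b a -> size a = size b -> k < size b -> sorted geq (block a b k).
Proof.
move=> a0 b0 dba zab kb.
rewrite /= (path_sortedE (rev_trans leq_trans)) sort_sorted => [|x y]; last exact: leq_total.
rewrite andbT; apply/allP=> x xs; apply: (block_le a0 b0 dba zab kb).
by rewrite inE xs orbT.
Qed.

(** Each letter i starts one block and occurs a_i - 1 times in the pieces,
    which only rearrange [spare_rows]. *)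
Lemma count_tableau_word (a b : seq nat) (i : nat) :
  all (ltn 0) a -> all (ltn 0) b -> sumn a = sumn b -> size a = size b ->
  i < size a -> count_mem i (tableau_word a b) = nth 0 a i.
Proof.
move=> a0 b0 sab zab ia; pose R := reshape (map predn b) (spare_rows a).
have sR : size R = size b by rewrite size_reshape size_map.
have RE : flatten R = spare_rows a.
  by rewrite reshapeKr // sumn_predn // size_spare_rows // sab zab.
have {}RE : \sum_(k <- iota 0 (size b)) count_mem i (nth [::] R k) = (nth 0 a i).-1.
  have -> : \sum_(k <- iota 0 (size b)) count_mem i (nth [::] R k) = count_mem i (spare_rows a).
    rewrite -RE count_flatten sumnE big_map -[X in _ = \sum_(_ <- X) _](take_size).
    by rewrite -(map_nth_iota0 [::] (leqnn _)) big_map sR.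
  rewrite count_flatten sumnE !big_map /=.
  rewrite (bigD1_seq i) ?mem_iota ?iota_uniq //= count_nseq /= eqxx mul1n.
  rewrite big1 ?addn0 // => j ji; rewrite count_nseq /= (negbTE ji) //.
rewrite count_flatten sumnE !big_map /=.
under eq_bigr => k _.
  rewrite (permP (permEl (perm_sort _ _))). over.
rewrite big_split /= RE (bigD1_seq i) ?mem_iota ?iota_uniq //= ?eqxx -?zab //.
rewrite big1 => [|j /negbTE->//].
by rewrite addn0 add1n prednK //; apply: (all_nthP 0 a0).
Qed.

Lemma nth_tableau_word (a b : seq nat) (k c : nat) :
  all (ltn 0) a -> all (ltn 0) b -> sumn a = sumn b -> size a = size b ->
  k < size b -> c < nth 0 b k ->
  nth 0 (tableau_word a b) (sumn (take k b) + c) = nth 0 (block a b k) c.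
Proof.
move=> a0 b0 sab zab kb cb; rewrite nth_flatten shape_blocks //.
rewrite -[sumn _ + c]/(flatten_index b k c) flatten_indexKl // flatten_indexKr //.
by rewrite nth_mkseq.
Qed.

Lemma size_block (a b : seq nat) (k : nat) :
  all (ltn 0) a -> all (ltn 0) b -> sumn a = sumn b -> size a = size b ->
  k < size b -> size (block a b k) = nth 0 b k.
Proof.
move=> a0 b0 sab zab kb; rewrite -[in RHS](shape_blocks a0 b0 sab zab).
by rewrite (nth_map [::]) ?size_mkseq // nth_mkseq.
Qed.

Lemma sumn_split (b : seq nat) (p : nat) : p < sumn b ->
  exists k c, [/\ k < size b, c < nth 0 b k & p = sumn (take k b) + c].
Proof.
move=> pb; exists (reshape_index b p), (reshape_offset b p).
by rewrite reshape_indexP // reshape_offsetP // [_ + _](reshape_indexK b p).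
Qed.

Lemma sumn_takeS (b : seq nat) (k : nat) : k < size b ->
  sumn (take k.+1 b) = sumn (take k b) + nth 0 b k.
Proof. by move=> kb; rewrite (take_nth 0 kb) sumn_rcons. Qed.

Lemma leq_sumn_take (b : seq nat) (k m : nat) : k <= m ->
  sumn (take k b) <= sumn (take m b).
Proof.
by move=> km; rewrite -(subnKC km) takeD sumn_cat leq_addr.
Qed.

Definition partial_sum (b : seq nat) (p : nat) : Prop :=
  exists k, [/\ 0 < k, k < size b & sumn (take k b) = p].

(** An (n, a)-reading presents a filling by plain functions on numbers, which
    avoids the dependent type of cells: f i j is the entry in row i and column
    j, and r v is the row of the entry v.  The second clause makes entries of
    different rows distinct, the third one is the first column condition. *)
Definition reading (n : nat) (a : seq nat) (f : nat -> nat -> nat)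
    (r : nat -> nat) : Prop :=
  [/\ forall i j, i < size a -> j < nth 0 a i -> 0 < f i j <= n,
      forall i j, i < size a -> j < nth 0 a i -> r (f i j) = i &
      forall i k, i < k -> k < size a -> f i 0 < f k 0].

Definition ascents_at (n : nat) (b : seq nat) (r : nat -> nat) : Prop :=
  forall p, 0 < p < n -> (r p < r p.+1 <-> partial_sum b p).

(** The third clause says that k first occurs as a new strict maximum; this
    single property orders the first occurrences.  The ascents are exactly the
    starts of blocks, since block k starts with k, while everything before it
    is smaller and the block itself weakly decreases. *)
Lemma immaculate_word (a b : seq nat) :
  all (ltn 0) a -> all (ltn 0) b -> sumn a = sumn b -> size a = size b ->
  dom_le b a ->
  exists w, [/\ size w = sumn a,
    forall i, i < size a -> count_mem i w = nth 0 a i,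
    forall k, k < size a -> exists s,
      [/\ s < size w, nth 0 w s = k & forall p, p < s -> nth 0 w p < k],
    forall p, p < size w -> nth 0 w p < size a &
    ascents_at (sumn a) b (fun v => nth 0 w v.-1)].
Proof.
move=> a0 b0 sab zab dba; set w := tableau_word a b.
have sw : size w = sumn a by rewrite size_flatten shape_blocks.
have bk k : k < size b -> 0 < nth 0 b k by exact: (all_nthP 0 b0).
have head k : k < size b -> nth 0 w (sumn (take k b)) = k.
  by move=> kb; rewrite -[sumn _]addn0 nth_tableau_word ?bk.
have wle k c : k < size b -> c < nth 0 b k ->
    nth 0 w (sumn (take k b) + c) <= k.
  move=> kb ck; rewrite nth_tableau_word //; apply: (block_le a0 b0 dba zab kb).
  by rewrite mem_nth // size_block.
have lew k p : k < size b -> p < sumn (take k b) -> nth 0 w p < k.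
  move=> kb pk; have pb : p < sumn b.
    by rewrite -[b]take_size; apply: leq_trans pk (leq_sumn_take _ (ltnW kb)).
  have [j [c [jb cj pE]]] := sumn_split pb.
  rewrite pE; apply: leq_ltn_trans (wle _ _ jb cj) _; rewrite ltnNge; apply/negP=> kj.
  by have := leq_sumn_take b kj; lia.
exists w; split=> //.
- by move=> i ia; apply: count_tableau_word.
- move=> k; rewrite zab => kb; exists (sumn (take k b)); split; [|exact: head|].
    rewrite sw sab -[X in _ < sumn X]take_size; apply: leq_trans (leq_sumn_take _ kb).
    by rewrite sumn_takeS //; have := bk k kb; lia.
  by move=> p; apply: lew.
- move=> p; rewrite sw sab zab => /sumn_split[k [c [kb ck ->]]].
  exact: leq_ltn_trans (wle _ _ kb ck) kb.
move=> p /andP[p0 pn]; split=> [|[k [k0 kb kp]]]; last first.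
  by rewrite -kp head // lew // kp; lia.
have /sumn_split[k [[|c] [kb ck pE]]] : p < sumn b by rewrite -sab.
  (* p is the start of block k, and k > 0 because p > 0 *)
  move=> _; exists k; split=> //; last by rewrite pE addn0.
  by case: k pE {kb ck} => // pE; move: p0; rewrite pE take0.
(* both letters lie in block k *)
rewrite pE addnS /= -addnS !nth_tableau_word ?(ltnW ck) //.
rewrite ltnNge => /negP[].
have := sorted_block a0 b0 dba zab kb.
move/(sorted_ltn_nth (rev_trans leq_trans) 0); apply; rewrite ?inE ?size_block //.
exact: ltnW.
Qed.

(** * Entries as positions in the word *)

(** Row i consists of the positions of i in the word, shifted by one because
    entries start at 1. *)
Lemma SIT_reading (n : nat) (a b : seq nat) : is_comp n a -> is_comp n b ->
  size a = size b -> dom_le b a ->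
  exists f r, [/\ reading n a f r,
    forall i j k, i < size a -> j < k -> k < nth 0 a i -> f i j < f i k,
    forall v, 0 < v <= n -> r v < size a & ascents_at n b r].
Proof.
move=> /andP[a0 /eqP an] /andP[b0 /eqP bn] zab dba.
have sab : sumn a = sumn b by rewrite an.
have [w [sw wa wfirst wlt wasc]] := immaculate_word a0 b0 sab zab dba.
pose pos i := [seq p <- iota 0 (size w) | nth 0 w p == i].
have spos i : i < size a -> size (pos i) = nth 0 a i.
  move=> ia; rewrite -wa // size_filter -[in RHS](mkseq_nth 0 w) count_map.
  exact: eq_count.
have posP i j : i < size a -> j < nth 0 a i ->
    nth 0 (pos i) j < n /\ nth 0 w (nth 0 (pos i) j) = i.
  move=> ia ja; have : nth 0 (pos i) j \in pos i by rewrite mem_nth // spos.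
  by rewrite mem_filter mem_iota sw an => /and3P[/eqP].
have posS i : sorted ltn (pos i).
  by apply: sorted_filter; [exact: ltn_trans | exact: iota_ltn_sorted].
have a_gt0 k : k < size a -> 0 < nth 0 a k by exact: (all_nthP 0 a0).
exists (fun i j => (nth 0 (pos i) j).+1), (fun v => nth 0 w v.-1); split.
- split=> [i j ia ja|i j ia ja|i k ik ka] /=.
  + by have [] := posP i j ia ja.
  + by have [] := posP i j ia ja.
  have ia := ltn_trans ik ka.
  have [s [sw' ws smax]] := wfirst i ia; have [t [_ wt tmax]] := wfirst k ka.
  have s_pos : s \in pos i by rewrite mem_filter mem_iota ws eqxx.
  (* first i <= s < t <= first k, as s is a position of i, and no k comes before t *)
  have le_s : nth 0 (pos i) 0 <= s.
    have /(nthP 0)[j ja <-] := s_pos.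
    case: j ja => // j ja; apply: ltnW; apply: (sorted_ltn_nth ltn_trans) => //.
    by rewrite inE spos ?a_gt0.
  have lt_st : s < t.
    rewrite ltnNge leq_eqVlt; apply/negP=> /predU1P[ts|/smax].
      by move: ik; rewrite -ws -wt ts ltnn.
    by rewrite wt; lia.
  have [_ wq] := posP k 0 ka (a_gt0 k ka).
  have : ~~ (nth 0 (pos k) 0 < t) by apply/negP=> /tmax; rewrite wq ltnn.
  by lia.
- move=> i j k ia jk ka; rewrite ltnS; apply: (sorted_ltn_nth ltn_trans) => //.
    by rewrite inE spos // (ltn_trans jk).
  by rewrite inE spos.
- by move=> [//|v] vn; apply: wlt; rewrite sw an.
by rewrite -an.
Qed.

Lemma nth_rev_sub (a : seq nat) i : i < size a ->
  nth 0 (rev a) (size a - i.+1) = nth 0 a i.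
Proof. by move=> ia; rewrite nth_rev; [congr nth|]; lia. Qed.

Lemma partial_sum_rev (n : nat) (b : seq nat) (p : nat) : is_comp n b ->
  partial_sum (rev b) (n - p) -> p < n -> partial_sum b p.
Proof.
move=> /andP[_ /eqP bn] [k [k0]]; rewrite size_rev => kb sk pn.
exists (size b - k); split; try lia.
move: sk bn; rewrite take_rev sumn_rev -[X in sumn X = n](cat_take_drop (size b - k)).
by rewrite sumn_cat; lia.
Qed.

(** Rotating by a half turn, v becomes n + 1 - v and row i becomes row
    size a - 1 - i.  An ascent of the rotated word at n - p is an ascent at p
    since both the order of the letters and their positions are reversed;
    the first column increases again for the same reason, whereas the rows are
    not reversed, so their entries now decrease. *)
Lemma SRIT_reading (n : nat) (a b : seq nat) : is_comp n a -> is_comp n b ->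
  size a = size b -> dom_le (rev b) (rev a) ->
  exists f r, [/\ reading n a f r,
    forall i j k, i < size a -> j < k -> k < nth 0 a i -> f i k < f i j &
    ascents_at n b r].
Proof.
move=> ca cb zab dba.
have rc s : is_comp n (rev s) = is_comp n s by rewrite /is_comp all_rev sumn_rev.
have [||||g [r [[gn rg g0] grow rlt rasc]]] := @SIT_reading n (rev a) (rev b).
- by rewrite rc.
- by rewrite rc.
- by rewrite !size_rev.
- exact: dba.
rewrite size_rev in gn rg g0 grow rlt.
have flip i : i < size a -> size a - i.+1 < size a by lia.
exists (fun i j => n.+1 - g (size a - i.+1) j), (fun v => size a - (r (n.+1 - v)).+1).
have gP i j : i < size a -> j < nth 0 a i ->
    0 < g (size a - i.+1) j <= n /\ r (g (size a - i.+1) j) = size a - i.+1.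
  move=> ia ja; have ja' : j < nth 0 (rev a) (size a - i.+1) by rewrite nth_rev_sub.
  by split; [apply: gn | apply: rg]; rewrite ?flip.
split.
- split=> [i j ia ja|i j ia ja|i k ik ka].
  + by have [] := gP i j ia ja; lia.
  + have [gi rgi] := gP i j ia ja.
    by rewrite subKn ?rgi; lia.
  have lt : g (size a - k.+1) 0 < g (size a - i.+1) 0 by apply: g0; lia.
  have a_gt0 : 0 < nth 0 a i.
    by case/andP: ca => /(all_nthP 0) + _; apply; lia.
  by have [gi _] := gP i 0 (ltn_trans ik ka) a_gt0; lia.
- move=> i j k ia jk ka.
  have := grow (size a - i.+1) j k (flip _ ia) jk; rewrite nth_rev_sub // => /(_ ka).
  by have [gi _] := gP i k ia ka; lia.
move=> p pn; rewrite -[X in _ <-> X](_ : partial_sum (rev b) (n - p) <-> _).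
  have np : 0 < n - p < n by lia.
  rewrite -(rasc _ np) subSS (_ : (n - p).+1 = n.+1 - p); last by lia.
  have r1 : r (n - p) < size a by apply: rlt; lia.
  have r2 : r (n.+1 - p) < size a by apply: rlt; lia.
  by split; lia.
split=> [/partial_sum_rev|psb]; first by apply=> //; lia.
apply: (@partial_sum_rev n); rewrite ?rc ?revK ?subKn //; lia.
Qed.

(** * Complements of compositions *)

Lemma set_of_compP (n : nat) (b : seq nat) (i : 'I_n) :
  reflect (partial_sum b i) (i \in set_of_comp n b).
Proof.
rewrite inE; apply: (iffP existsP) => [[k /andP[k0 /eqP ki]]|[k [k0 kb ki]]].
  by exists k; split.
by exists (Ordinal kb); rewrite /= k0 ki /=.
Qed.

Lemma set_of_comp_sub (n : nat) (b : seq nat) : is_comp n b ->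
  set_of_comp n b \subset interval_pred n.
Proof.
move=> /andP[b0 _]; apply/subsetP=> i /set_of_compP[[|k] [// _ kb ki]]; rewrite inE -ki.
by rewrite sumn_takeS ?ltn_addl ?(ltnW kb) //; apply: (all_nthP 0 b0); apply: ltnW.
Qed.

Lemma card_interval_pred (n : nat) : #|interval_pred n| = n.-1.
Proof.
case: n => [|n]; first by apply: eq_card0; case.
rewrite -[n in RHS]/(n.+1.-1) -[n.+1 in RHS]card_ord -[in RHS](cardC1 (@ord0 n)).
by apply: eq_card => i; rewrite !inE lt0n.
Qed.

Lemma size_comp_of_set (n : nat) (S : {set 'I_n}) : size (comp_of_set S) = #|S|.+1.
Proof. by rewrite size_pairmap size_rcons size_map cardE. Qed.

Lemma size_comp_compl (n : nat) (b : seq nat) : 0 < n -> is_comp n b ->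
  size (comp_compl n b) = n + 1 - size b.
Proof.
move=> n0 cb; have sb := set_of_comp_sub cb.
rewrite /comp_compl size_comp_of_set cardsD (setIidPr sb).
have := subset_leq_card sb; rewrite card_interval_pred.
have := size_comp_of_set (set_of_comp n b); rewrite comp_of_setK //.
by lia.
Qed.

Lemma comp_compl_comp (n : nat) (b : seq nat) : 0 < n ->
  is_comp n (comp_compl n b).
Proof. by move=> n0; apply: comp_of_setP (subsetDl _ _). Qed.

Lemma comp_complK (n : nat) (b : seq nat) : 0 < n -> is_comp n b ->
  comp_compl n (comp_compl n b) = b.
Proof.
move=> n0 cb; rewrite {1}/comp_compl set_of_compK // ?subsetDl // setDDr setDv set0U.
by rewrite (setIidPr (set_of_comp_sub cb)) comp_of_setK.
Qed.

(** * From readings to fillings *)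

Lemma cell_eq (a : seq nat) (c d : cell a) : row c = row d -> col c = col d -> c = d.
Proof.
case: c d => [i j] [k l]; rewrite /row /col /= => /val_inj ik.
by case: _ / ik l => l /val_inj ->.
Qed.

Lemma card_cell (a : seq nat) : #|{: cell a}| = sumn a.
Proof.
rewrite card_tagged -[in RHS](mkseq_nth 0 a); congr sumn.
rewrite /mkseq -val_enum_ord -map_comp; apply: eq_map => i /=.
by rewrite card_ord.
Qed.

Definition fill (n : nat) (a : seq nat) (f : nat -> nat -> nat) : filling n a :=
  [ffun c => inord (f (row c) (col c))].

Lemma fillE (n : nat) (a : seq nat) f r (c : cell a) : reading n a f r ->
  fill n a f c = f (row c) (col c) :> nat.
Proof.
move=> [fn _ _]; rewrite ffunE inordK // ltnS.
by have /andP[] := fn _ _ (ltn_ord (tag c)) (ltn_ord (tagged c)).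
Qed.

Lemma row_fill (n : nat) (a : seq nat) f r (c : cell a) : reading n a f r ->
  r (fill n a f c) = row c.
Proof.
move=> rd; rewrite (fillE _ rd); case: rd => _ rf _.
exact: rf (ltn_ord (tag c)) (ltn_ord (tagged c)).
Qed.

(** Injectivity within rows suffices, since a reading separates rows; the
    entries then exhaust 1, ..., n because a has n cells. *)
Lemma fill_bij (n : nat) (a : seq nat) f r : is_comp n a -> reading n a f r ->
  (forall c d : cell a, row c = row d -> col c < col d ->
     f (row c) (col c) <> f (row d) (col d)) ->
  bij_filling (fill n a f).
Proof.
move=> /andP[_ /eqP an] rd neq.
have inj : injective (fill n a f).
  move=> c d cd; have rE : row c = row d by rewrite -!(row_fill _ rd) cd.
  apply: cell_eq => //; move/(congr1 val): cd; rewrite /= !(fillE _ rd) => cd.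
  case: (ltngtP (col c) (col d)) => // lt; first by case: (neq c d).
  by case: (neq d c).
rewrite /bij_filling (introT (injectiveP _) inj) /=.
have sub : codom (fill n a f) \subset [pred v : 'I_n.+1 | 0 < v].
  apply/subsetP=> _ /codomP[c ->]; rewrite inE (fillE _ rd); case: rd => fn _ _.
  by have /andP[] := fn _ _ (ltn_ord (tag c)) (ltn_ord (tagged c)).
have /subset_cardP/(_ sub) E : #|codom (fill n a f)| = #|[pred v : 'I_n.+1 | 0 < v]|.
  rewrite card_codom // card_cell an -[LHS](card_interval_pred n.+1).
  by apply: eq_card => v; rewrite !inE.
by apply/forallP=> v; rewrite E inE.
Qed.

Lemma fill_first_col (n : nat) (a : seq nat) f r : reading n a f r ->
  first_col_incr (fill n a f).
Proof.
move=> rd; apply/forallP=> c; apply/forallP=> d; apply/implyP=> /and3P[/eqP c0 /eqP d0 cd].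
rewrite !(fillE _ rd) c0 d0; case: rd => _ _; apply=> //.
exact: ltn_ord (tag d).
Qed.

Lemma entry_cell (n : nat) (a : seq nat) (T : filling n a) (v : nat) :
  bij_filling T -> 0 < v -> v <= n -> exists c, T c = v :> nat.
Proof.
move=> /andP[_ /forallP bij] v0 vn.
have /eqP := bij (Ordinal (vn : v < n.+1)); rewrite v0 => /codomP[c cE].
by exists c; rewrite -cE.
Qed.

(** Each of i and i + 1 occupies exactly one cell, so either i + 1 is strictly
    higher than i or it is not. *)
Lemma DesRS_compl (n : nat) (a : seq nat) (T : filling n a) : bij_filling T ->
  DesRS T = interval_pred n :\: DesS T.
Proof.
move=> bij; have /andP[/injectiveP inj _] := bij.
have uniq c d v : val (T c) = v -> val (T d) = v -> c = d.
  by move=> cv dv; apply/inj/val_inj; rewrite cv dv.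
apply/setP=> i; rewrite !inE; case: (posnP i) => [->|i0]; rewrite ?andbF //= andbT.
have [c cE] := entry_cell bij i0 (ltnW (ltn_ord i)).
have [d dE] := entry_cell bij (ltn0Sn i) (ltn_ord i).
have rowsP (P : rel nat) : [exists c', exists d',
    [&& val (T c') == i, val (T d') == i.+1 & P (row c') (row d')]] = P (row c) (row d).
  apply/existsP/idP => [[c' /existsP[d' /and3P[/eqP c'E /eqP d'E]]]|Pcd].
    by rewrite (uniq _ _ _ c'E cE) (uniq _ _ _ d'E dE).
  by exists c; apply/existsP; exists d; rewrite /= cE dE !eqxx.
by rewrite (rowsP (fun x y => y <= x)) (rowsP ltn) -leqNgt.
Qed.

Lemma DesS_fill (n : nat) (a b : seq nat) f r : is_comp n b ->
  bij_filling (fill n a f) -> reading n a f r -> ascents_at n b r ->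
  DesS (fill n a f) = set_of_comp n b.
Proof.
move=> cb bij rd asc; apply/setP=> i.
have [i_set|] := set_of_compP; last first.
  apply: contra_notF; rewrite !inE => /andP[i0 /existsP[c /existsP[d /and3P[/eqP cE /eqP dE]]]].
  by rewrite -!(row_fill _ rd) cE dE -asc ?i0 /=.
have i0 : 0 < i.
  by have := subsetP (set_of_comp_sub cb) i (introT (set_of_compP _ _) i_set); rewrite inE.
have [c cE] := entry_cell bij i0 (ltnW (ltn_ord i)).
have [d dE] := entry_cell bij (ltn0Sn i) (ltn_ord i).
rewrite !inE i0; apply/existsP; exists c; apply/existsP; exists d.
by rewrite /= cE dE !eqxx -!(row_fill _ rd) cE dE asc ?i0 /=.
Qed.

(** * Existence of tableaux *)

Lemma SIT_set_of_comp (n : nat) (a b : seq nat) : is_comp n a -> is_comp n b ->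
  size a = size b -> dom_le b a ->
  exists2 T, T \in SIT n a & DesS T = set_of_comp n b.
Proof.
move=> ca cb zab /(SIT_reading ca cb zab)[f [r [rd incr _ asc]]].
have frow (c d : cell a) : row c = row d -> col c < col d ->
    f (row c) (col c) < f (row d) (col d).
  move=> rE lt; rewrite rE; apply: incr lt _; first exact: ltn_ord (tag d).
  exact: ltn_ord (tagged d).
have bij : bij_filling (fill n a f).
  by apply: (fill_bij ca rd) => c d rE /(frow _ _ rE) lt E; rewrite E ltnn in lt.
exists (fill n a f); last exact: (DesS_fill cb bij rd asc).
rewrite inE bij (fill_first_col rd) /=.
apply/forallP=> c; apply/forallP=> d; apply/implyP=> /andP[/eqP rE lt].
by rewrite !(fillE _ rd) frow.
Qed.

Lemma SRIT_set_of_comp (n : nat) (a b : seq nat) : is_comp n a -> is_comp n b ->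
  size a = size b -> dom_le (rev b) (rev a) ->
  exists2 T, T \in SRIT n a & DesS T = set_of_comp n b.
Proof.
move=> ca cb zab /(SRIT_reading ca cb zab)[f [r [rd decr asc]]].
have frow (c d : cell a) : row c = row d -> col c < col d ->
    f (row d) (col d) < f (row c) (col c).
  move=> rE lt; rewrite rE; apply: decr lt _; first exact: ltn_ord (tag d).
  exact: ltn_ord (tagged d).
have bij : bij_filling (fill n a f).
  by apply: (fill_bij ca rd) => c d rE /(frow _ _ rE) lt E; rewrite E ltnn in lt.
exists (fill n a f); last exact: (DesS_fill cb bij rd asc).
rewrite inE bij (fill_first_col rd) /=.
apply/forallP=> c; apply/forallP=> d; apply/implyP=> /andP[/eqP rE lt].
by rewrite !(fillE _ rd) frow.
Qed.

Theorem corollary6p11 (n : nat) (n_ge1 : 1 <= n) (a b : seq nat)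
    (a_comp : is_comp n a) (b_comp : is_comp n b) :
  [/\ dom_le b a -> size a = size b ->
        SIT_S n a b != set0,
      dom_le (rev b) (rev a) -> size a = size b ->
        SRIT_S n a b != set0,
      dom_le (comp_compl n b) a -> size a = n + 1 - size b ->
        SIT_RS n a b != set0
    & dom_le (comp_transp n b) (rev a) -> size a = n + 1 - size b ->
        SRIT_RS n a b != set0].
Proof.
have bc_comp := comp_compl_comp b n_ge1; have szc := size_comp_compl n_ge1 b_comp.
have bcK (T : filling n a) : bij_filling T ->
    DesS T = set_of_comp n (comp_compl n b) -> comp_of_set (DesRS T) = b.
  move=> bij DT; rewrite DesRS_compl // DT; exact: comp_complK.
split=> [ba zab|ba zab|ba zab|ba zab]; apply/set0Pn.
- have [T TS DT] := SIT_set_of_comp a_comp b_comp zab ba.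
  by exists T; rewrite inE TS DT comp_of_setK /=.
- have [T TS DT] := SRIT_set_of_comp a_comp b_comp zab ba.
  by exists T; rewrite inE TS DT comp_of_setK /=.
- rewrite -szc in zab; have [T TS DT] := SIT_set_of_comp a_comp bc_comp zab ba.
  by exists T; rewrite inE TS bcK //=; move: TS; rewrite inE => /andP[].
- rewrite -szc in zab; have [T TS DT] := SRIT_set_of_comp a_comp bc_comp zab ba.
  by exists T; rewrite inE TS bcK //=; move: TS; rewrite inE => /andP[].
Qed.
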